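(* The real Banach space $X_{1/2}=(\mathbb{R}^2,\|\cdot\|_{1/2})$, whose norm is given by $$\|(\xi,\eta)\|_{1/2}=\max\{|\eta|,\ |\xi|+\tfrac12|\eta|\},\qquad (\xi,\eta)\in\mathbb{R}^2,$$ has the (T)-property, and thus it has the Mazur-Ulam property.
   Context: All spaces are over the real field. For a Banach space $X$, $S_X$ is its unit sphere. For $x\in S_X$, the star of $x$ with respect to $S_X$ is $St(x)=\{y\in S_X : \|y+x\|=2\}$. A convex subset $C$ of $S_X$ is a maximal convex subset of $S_X$ if it is not properly contained in any other convex subset of $S_X$. A Banach space $X$ has the (T)-property if there exists a subset $\{x_\gamma:\gamma\in\Gamma\}$ of $S_X$ such that: (i) for any $\gamma\in\Gamma$, $St(x_\gamma)$ is a maximal convex subset of $S_X$; (ii) $S_X=\bigcup\{St(x_\gamma):\gamma\in\Gamma\}$; (iii) for every $x\in S_X$, $\gamma\in\Gamma$ and $\varepsilon>0$ there exist $x^+_\gamma\in St(x_\gamma)$ and $x^-_\gamma\in St(-x_\gamma)$ such that $\|x-x^+_\gamma\|+\|x-x^-_\gamma\|\leq 2+\varepsilon$. A Banach space $X$ has the Mazur-Ulam property (MUP) if for every Banach space $Y$, every surjective isometry $T:S_X\to S_Y$ between the unit spheres is the restriction of a linear isometry between the two spaces $X$ and $Y$. *)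

(* Defs.v *)
From HB Require Import structures.
From mathcomp Require Import all_boot all_order all_algebra.
From mathcomp Require Import all_classical all_reals all_analysis.
From mathcomp Require Import lra.

Set Implicit Arguments.
Unset Strict Implicit.
Unset Printing Implicit Defensive.

Import Order.TTheory GRing.Theory Num.Theory.
Import numFieldNormedType.Exports.

Local Open Scope classical_set_scope.
Local Open Scope ring_scope.

Definition unit_sphere (R : realType) (X : completeNormedModType R) : set X :=
  [set x | `|x| = 1].
Arguments unit_sphere {R} X _.

Definition star (R : realType) (X : completeNormedModType R) (x : X) : set X :=
  [set y | unit_sphere X y /\ `|y + x| = 2].

Definition maximal_convex_subset (R : realType) (X : completeNormedModType R)
    (S C : set X) : Prop :=
  [/\ C `<=` S, convex_set C &
      forall D : set X, D `<=` S -> convex_set D -> ~ (C `<` D)].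

(* The family (x_gamma) is given by the set G of its members: the condition
   does not depend on how the members are indexed. *)
Definition T_property (R : realType) (X : completeNormedModType R) : Prop :=
  exists G : set X,
    [/\ G `<=` unit_sphere X,
        forall g, G g -> maximal_convex_subset (unit_sphere X) (star g),
        unit_sphere X = \bigcup_(g in G) star g &
        forall x g (eps : R), unit_sphere X x -> G g -> 0 < eps ->
          exists xp xm : X, [/\ star g xp, star (- g) xm &
            `|x - xp| + `|x - xm| <= 2 + eps]].

(* A map between the spheres is represented by a map T : X -> Y whose values
   outside the sphere of X are irrelevant. *)
Definition Mazur_Ulam_property (R : realType) (X : completeNormedModType R) :
    Prop :=
  forall (Y : completeNormedModType R) (T : X -> Y),
    T @` unit_sphere X = unit_sphere Y ->
    {in unit_sphere X &, forall x x', `|T x - T x'| = `|x - x'|} ->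
    exists L : {linear X -> Y},
      [/\ forall x, `|L x| = `|x|, range L = [set: Y] &
          {in unit_sphere X, forall x, T x = L x}].

(* An alias of R * R: the product type itself carries the max norm. *)
Definition X_half (R : realType) : Type := (R * R)%type.

Section XHalf.
Variable R : realType.

HB.instance Definition _ := GRing.Lmodule.copy (X_half R) (R^o * R^o)%type.

Definition half_norm (x : X_half R) : R :=
  Num.max `|x.2| (`|x.1| + 2^-1 * `|x.2|).

Let half_normD x y : half_norm (x + y) <= half_norm x + half_norm y.
Proof.
case: x y => [a b] [c d]; rewrite /half_norm /=.
have h1 := ler_normD a c; have h2 := ler_normD b d.
have [mx1 mx2] : `|b| <= half_norm (a, b) /\
    `|a| + 2^-1 * `|b| <= half_norm (a, b).
  by rewrite /half_norm !le_max !lexx orbT.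
have [my1 my2] : `|d| <= half_norm (c, d) /\
    `|c| + 2^-1 * `|d| <= half_norm (c, d).
  by rewrite /half_norm !le_max !lexx orbT.
move: mx1 mx2 my1 my2; rewrite /half_norm /= => *.
by rewrite ge_max; apply/andP; split; lra.
Qed.

Let half_normZ (l : R) x : half_norm (l *: x) = `|l| * half_norm x.
Proof.
case: x => [a b]; rewrite /half_norm /= !normrM maxr_pMr//.
by rewrite mulrDr mulrCA.
Qed.

Let half_norm0_eq0 x : half_norm x = 0 -> x = 0.
Proof.
case: x => [a b]; rewrite /half_norm /= => h.
have : `|b| <= 0 by rewrite -h le_max lexx.
have : `|a| + 2^-1 * `|b| <= 0 by rewrite -[leRHS]h le_max lexx orbT.
have := normr_ge0 a; have := normr_ge0 b => b0 a0 h1 h2.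
have /eqP : `|a| = 0 by lra.
have /eqP : `|b| = 0 by lra.
by rewrite !normr_eq0 => /eqP -> /eqP ->.
Qed.

HB.instance Definition _ :=
  Lmodule_isNormed.Build R (X_half R) half_normD half_normZ half_norm0_eq0.

Lemma X_half_normE (x : X_half R) :
  `|x| = Num.max `|x.2| (`|x.1| + 2^-1 * `|x.2|).
Proof. by []. Qed.

Let le_fst (x : X_half R) : `|x.1| <= `|x|.
Proof.
rewrite X_half_normE le_max; apply/orP; right.
by rewrite lerDl mulr_ge0// invr_ge0.
Qed.

Let le_snd (x : X_half R) : `|x.2| <= `|x|.
Proof. by rewrite X_half_normE le_max lexx. Qed.

Let X_half_complete (F : set_system (X_half R)) :
  ProperFilter F -> cauchy F -> cvg F.
Proof.
move=> PF cF.
have cF' (f : X_half R -> R) : (forall x y, `|f x - f y| <= `|x - y|) ->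
    cvg (f @ F).
  move=> fle; apply: cauchy_cvg.
  apply/cauchy_ballP => _/posnumP[e].
  have /cauchy_ballP /(_ e%:num (gt0 e)) := cF.
  case=> -[A B] [/= FA FB] AB.
  exists (f @` A, f @` B) => /=.
    by split; [apply: filterS FA | apply: filterS FB] => z /= ?; exists z.
  move=> [_ _] /= [[x Ax <-] [y By <-]].
  have := AB (x, y) (conj Ax By).
  by rewrite /= -!ball_normE /=; exact: le_lt_trans.
have c1 : cvg ((fst : X_half R -> R) @ F).
  by apply: cF' => x y; exact: (le_fst (x - y)).
have c2 : cvg ((snd : X_half R -> R) @ F).
  by apply: cF' => x y; exact: (le_snd (x - y)).
pose l : X_half R :=
  (lim ((fst : X_half R -> R) @ F), lim ((snd : X_half R -> R) @ F)).
apply: (@cvgP _ F l); apply/cvgrPdist_lt => e e0.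
have e2 : 0 < e / 2 by rewrite divr_gt0.
have h1 : \forall x \near F, `|l.1 - x.1| < e / 2.
  exact: (@cvgr_dist_lt R R^o _ F _ (fst : X_half R -> R^o) l.1 c1).
have h2 : \forall x \near F, `|l.2 - x.2| < e / 2.
  exact: (@cvgr_dist_lt R R^o _ F _ (snd : X_half R -> R^o) l.2 c2).
near=> x.
have k1 : `|l.1 - x.1| < e / 2 by near: x.
have k2 : `|l.2 - x.2| < e / 2 by near: x.
have := normr_ge0 (l.1 - x.1); have := normr_ge0 (l.2 - x.2).
rewrite X_half_normE /= gt_max => *.
by apply/andP; split; lra.
Unshelve. all: by end_near. Qed.

HB.instance Definition _ :=
  Uniform_isComplete.Build (X_half R) X_half_complete.

End XHalf.

(* Main.v *)
Require Import Defs.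
From HB Require Import structures.
From mathcomp Require Import all_boot all_order all_algebra.
From mathcomp Require Import all_classical all_reals all_analysis.
From mathcomp Require Import ring lra.

Import Order.TTheory GRing.Theory Num.Theory.
Set Implicit Arguments.
Unset Strict Implicit.
Unset Printing Implicit Defensive.
Local Open Scope classical_set_scope.
Local Open Scope ring_scope.

(** The unit ball of the norm is an affinely regular hexagon.  If u, v are
consecutive vertices, then so are v and v - u, and six such rotations come back
to (u, v); in the basis (u, v) the norm of s u + t v is always
max(|s|, |t|, |s + t|).  Everything below is therefore proved for one arbitrary
edge [u, v].

(T)-property: take the six midpoints of the edges.  The star of a midpoint is
its whole edge (star_edge), and a convex star is automatically a maximal convex
subset of the sphere (maximal_convex_star).  A unit vector s u + t v lies at
distance at most 1 - (s + t) from the edge [u, v] and at most 1 + (s + t) from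
the opposite edge, so the two distances add up to at most 2.

Mazur-Ulam property: let T be a surjective isometry from the hexagon onto the
unit sphere of Y.  The sphere of Y is symmetric, so x |-> T^-1(- T x) maps the
hexagon to itself, preserves distances and moves every point by 2.  A point at
distance 2 from an interior point of an edge lies on the opposite edge, so this
map sends each edge to the opposite one, each vertex to its negative, and hence
every x to - x: T is odd (antipode).  Consequently T also preserves norms of
sums.  Now T v - T u has norm 1, so it is T z for some z, and the distances from
z to - u and to v leave only z = v - u (edge_rot_image): T respects the linear
relations between the vertices.  Finally |T u + T v| = |u + v| = 2 forces the
segment [T u, T v] into the sphere of Y, and a point of an edge is determined by
its distances to the two end points (edge_between), so T is affine on each edge
(edge_image).  Thus T agrees on the sphere with the linear map that has the same
values at two consecutive vertices; homogeneity makes that map a surjective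
isometry. *)

(** * Coordinates with respect to two vectors *)

Section Combination.
Variables (R : realType) (V : lmodType R).
Implicit Types (u v : V) (s t c : R).

Definition comb u v s t : V := s *: u + t *: v.

Lemma combD u v s t s' t' :
  comb u v s t + comb u v s' t' = comb u v (s + s') (t + t').
Proof. by rewrite /comb !scalerDl addrACA. Qed.

Lemma combZ u v c s t : c *: comb u v s t = comb u v (c * s) (c * t).
Proof. by rewrite /comb scalerDr !scalerA. Qed.

Lemma combN u v s t : - comb u v s t = comb u v (- s) (- t).
Proof. by rewrite /comb opprD !scaleNr. Qed.

Lemma combB u v s t s' t' :
  comb u v s t - comb u v s' t' = comb u v (s - s') (t - t').
Proof. by rewrite combN combD. Qed.

Lemma comb10 u v : comb u v 1 0 = u.
Proof. by rewrite /comb scale1r scale0r addr0. Qed.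

Lemma comb01 u v : comb u v 0 1 = v.
Proof. by rewrite /comb scale1r scale0r add0r. Qed.

Lemma comb_rot u v s t : comb v (v - u) s t = comb u v (- t) (s + t).
Proof. by rewrite /comb scalerBr scalerDl scaleNr addrA addrC. Qed.

Lemma comb_rotV u v s t : comb (u - v) u s t = comb u v (s + t) (- s).
Proof. by rewrite /comb scalerBr scalerDl scaleNr addrAC. Qed.

End Combination.

(** * The hexagonal unit sphere *)

Section Hexagon.
Variable R : realType.
Notation X := (X_half R).
Implicit Types (u v x y z : X) (s t a c : R).

(** The ordered pairs of consecutive vertices of the hexagon, in one sense of
rotation: the base edge and its successive images under the rotation of order 6
that maps u to v and v to v - u. *)
Inductive edge : X -> X -> Prop :=
| edge_base : edge ((1, 0) : X) ((2^-1, 1) : X)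
| edge_rot u v : edge u v -> edge v (v - u).

Lemma edgeN u v : edge u v -> edge (- u) (- v).
Proof.
by do 3!move/edge_rot; rewrite [v - u - v]addrC addKr opprB addKr.
Qed.

Lemma edge_rotV u v : edge u v -> edge (u - v) u.
Proof.
by move/edgeN; do 2!move/edge_rot; rewrite !opprK [- v + u]addrC subrK.
Qed.

Lemma edge_coord u v x : edge u v -> exists s t, x = comb u v s t.
Proof.
move=> uv; elim: uv x => [|{}u {}v _ IH] x.
  exists (x.1 - x.2 / 2), x.2; case: x => x1 x2; congr pair => /=.
    by rewrite /GRing.scale /=; lra.
  by rewrite /GRing.scale /=; lra.
have [s [t ->]] := IH x.
by exists (s + t), (- s); rewrite comb_rot; congr comb; ring.
Qed.

Definition hexnorm s t : R := Num.max (Num.max `|s| `|t|) `|s + t|.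

(** The formula is invariant under the rotation of coordinates
(s, t) |-> (- t, s + t), so the base edge decides; there
|s + t/2| + |t|/2 = max(|s|, |s + t|). *)
Lemma edge_norm u v s t : edge u v -> `|comb u v s t| = hexnorm s t.
Proof.
move=> uv; elim: uv s t => [|{}u {}v _ IH] s t; last first.
  rewrite comb_rot IH /hexnorm normrN; have -> : - t + (s + t) = s by ring.
  by rewrite maxAC [Num.max `|t| _]maxC.
have -> : comb ((1, 0) : X) (2^-1, 1) s t = (s + t / 2, t).
  congr pair => /=; first by rewrite /GRing.scale /=; lra.
  by rewrite scaler0 add0r; exact: mulr1.
rewrite X_half_normE /hexnorm /=.
have -> : `|s + t / 2| + 2^-1 * `|t| = Num.max `|s| `|s + t|.
  by case: (ger0P s); case: (ger0P t); case: (ger0P (s + t));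
    case: (ger0P (s + t / 2)) => *; case: leP; lra.
by rewrite maxA [Num.max `|t| _]maxC.
Qed.

Lemma edge_norm_le u v s t c : edge u v ->
  `|comb u v s t| <= c <->
  [/\ - c <= s /\ s <= c, - c <= t /\ t <= c & - c <= s + t /\ s + t <= c].
Proof.
move=> uv; rewrite edge_norm// /hexnorm !ge_max !ler_norml; split.
  by move=> /andP[/andP[/andP[? ?] /andP[? ?]] /andP[? ?]].
by move=> [[-> ->] [-> ->] [-> ->]].
Qed.

Lemma edge_norm_ge u v s t c : edge u v -> c <= `|comb u v s t| ->
  [\/ c <= `|s|, c <= `|t| | c <= `|s + t|].
Proof.
by move=> uv; rewrite edge_norm// !le_max => /orP[/orP[]|] ?;
  [constructor 1|constructor 2|constructor 3].
Qed.

Lemma edge_point u v a : edge u v -> 0 <= a <= 1 -> `|comb u v (1 - a) a| = 1.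
Proof.
move=> uv a01; rewrite edge_norm// /hexnorm subrK normr1; apply/max_idPr.
by rewrite ge_max !ler_norml; lra.
Qed.

Lemma edge_vertex u v : edge u v -> `|u| = 1.
Proof.
move=> uv; rewrite -(comb10 u v) -[X in comb _ _ X _](subr0 1).
by rewrite edge_point// lexx ler01.
Qed.

Lemma edge_cover x : `|x| = 1 ->
  exists u v a, [/\ edge u v, 0 <= a <= 1 & x = comb u v (1 - a) a].
Proof.
have e0 := edge_base; have [s [t ->]] := edge_coord x e0.
move: ((1, 0) : X) ((2^-1, 1) : X) e0 => u v uv.
(* By central symmetry x is in the half plane t >= 0; the signs of s and s + t
   then tell which of the three consecutive edges of that half contains x. *)
wlog t0 : u v s t uv / 0 <= t => [hw st1|].
  have [|/ltW t0] := leP 0 t; first by move=> t0; exact: (hw u v s t).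
  have -> : comb u v s t = comb (- u) (- v) (- s) (- t).
    by rewrite /comb !scaleNr !scalerN !opprK.
  apply: hw; [exact: edgeN|lra|].
  by rewrite /comb !scaleNr !scalerN !opprK.
move=> st1; have [|[s1 s1'] [t1 t1'] [st st']] := (edge_norm_le s t 1 uv).1.
  by rewrite st1.
have uv1 := edge_rot uv; have uv2 := edge_rot uv1.
have := edge_norm_ge (s := s) (t := t) (c := 1) uv.
rewrite st1 => /(_ (lexx _)).
rewrite (ger0_norm t0).
have [s0|s0] := leP 0 s.
  rewrite !ger0_norm ?addr_ge0// => h.
  exists u, v, t; split=> //; first lra.
  by congr comb; case: h; lra.
rewrite (ltr0_norm s0); have [st0|st0] := leP 0 (s + t).
  rewrite ger0_norm// => h.
  exists v, (v - u), (- s); split=> //; first lra.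
  by rewrite comb_rot; congr comb; case: h; lra.
rewrite ltr0_norm// => h.
exists (v - u), (v - u - v), (- (s + t)); split=> //; first lra.
by rewrite comb_rot comb_rot; congr comb; case: h; lra.
Qed.

(** An edge has length 1, so the assumptions say that z is metrically between
the end points.  In a hexagonal norm two points can have many metric midpoints;
the direction v - u of an edge is a vertex of the ball, which makes the point
between u and v unique. *)
Lemma edge_between u v z a : edge u v ->
  `|z - u| <= a -> `|z - v| <= 1 - a -> z = comb u v (1 - a) a.
Proof.
move=> uv; have [s [t ->]] := edge_coord z uv.
have -> : comb u v s t - u = comb u v (s - 1) (t - 0).
  by rewrite -combB comb10.
have -> : comb u v s t - v = comb u v (s - 0) (t - 1).
  by rewrite -combB comb01.
move=> /(edge_norm_le _ _ _ uv)[[? ?] [? ?] [? ?]].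
move=> /(edge_norm_le _ _ _ uv)[[? ?] [? ?] [? ?]].
by congr comb; lra.
Qed.

(** The only supporting functional of the ball at an interior point of [u, v]
is s u + t v |-> s + t, so it takes the value 1 at every unit vector that forms a
sum of norm 2 with that point. *)
Lemma edge_normD_eq2 u v a s t : edge u v -> 0 < a < 1 ->
  `|comb u v s t| <= 1 -> `|comb u v s t + comb u v (1 - a) a| = 2 ->
  s + t = 1.
Proof.
move=> uv a01 /(edge_norm_le _ _ _ uv)[[? ?] [? ?] [? ?]].
rewrite combD => h; apply/eqP; rewrite eq_le; apply/andP; split; first by [].
have := edge_norm_ge (s := s + (1 - a)) (t := t + a) (c := 2) uv.
rewrite h => /(_ (lexx _)) []; rewrite ler_normr => /orP[]; lra.
Qed.

Lemma star_edge u v a : edge u v -> 0 < a < 1 ->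
  star (comb u v (1 - a) a) = [set comb u v (1 - b) b | b in `[0, 1]].
Proof.
move=> uv a01; rewrite eqEsubset; split=> [y [y1 ya]|_ [b b01 <-]].
  have [s [t yst]] := edge_coord y uv.
  have st : s + t = 1.
    by apply: edge_normD_eq2 uv a01 _ _; rewrite -yst ?y1.
  have [|[s1 s1'] [t1 t1'] [st1 st1']] := (edge_norm_le s t 1 uv).1.
    by rewrite -yst y1.
  exists t; first by rewrite /= in_itv /=; lra.
  by rewrite yst; congr comb; lra.
move: b01; rewrite /= in_itv /= => b01; split; first exact: edge_point.
rewrite combD edge_norm// /hexnorm.
have -> : 1 - b + (1 - a) + (b + a) = 2 by ring.
rewrite [X in Num.max _ X]ger0_norm//; apply/max_idPr.
by rewrite ge_max !ler_norml; lra.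
Qed.

Lemma edge_coord_bounds u v x : edge u v -> `|x| = 1 ->
  exists s t, [/\ x = comb u v s t, -1 <= s /\ s <= 1, -1 <= t /\ t <= 1 &
    -1 <= s + t /\ s + t <= 1].
Proof.
move=> uv x1; have [s [t xst]] := edge_coord x uv; exists s, t.
have [|? ? ?] := (edge_norm_le s t 1 uv).1; first by rewrite -xst x1.
by split.
Qed.

Lemma convex_edge u v :
  convex_set ([set comb u v (1 - b) b | b in `[0, 1]] : set X).
Proof.
move=> x y l; rewrite !inE => -[b + <-] [b' + <-].
rewrite /= !in_itv /= => b01 b01'.
have l0 : 0 <= l%:num by []. have l1 : l%:num <= 1 by [].
exists (l%:num * b + (1 - l%:num) * b').
  by rewrite /= in_itv /=; nra.
transitivity (l%:num *: comb u v (1 - b) b +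
              (1 - l%:num) *: comb u v (1 - b') b') => //.
by rewrite !combZ combD; congr comb; ring.
Qed.

End Hexagon.

(** * The (T)-property *)

(** A larger convex subset D of the sphere contains x itself; the midpoint of x
and any y in D has norm 1, which puts y in the star. *)
Lemma maximal_convex_star (R : realType) (X : completeNormedModType R) (x : X) :
  unit_sphere X x -> convex_set (star x) ->
  maximal_convex_subset (unit_sphere X) (star x).
Proof.
move=> x1 cx; split=> //; first by move=> y [].
move=> D DS cD [xD]; apply => y Dy; split; first exact: DS.
have Dx : D x.
  by apply: xD; split=> //; rewrite -mulr2n normrMn x1.
have h0 : 0 <= 2^-1 :> R by lra.
have h1 : 2^-1 <= 1 :> R by lra.
have := cD y x (Itv01 h0 h1); rewrite !inE => /(_ Dy Dx)/DS.
rewrite /unit_sphere /= => mid1.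
have -> : y + x = 2 *: conv (Itv01 h0 h1) (y : convex_lmodType X) x.
  rewrite [conv _ _ _]/(2^-1 *: y + (1 - 2^-1) *: x) scalerDr !scalerA.
  have -> : 2 * (1 - 2^-1) = 1 :> R by lra.
  by rewrite divff// !scale1r.
by rewrite normrZ mid1 mulr1 ger0_norm.
Qed.

Lemma X_half_T_property (R : realType) : T_property (X_half R).
Proof.
exists [set m | exists u v, edge u v /\ m = comb u v (1 - 2^-1) 2^-1].
have h01 : 0 < (2^-1 : R) < 1 by lra.
split.
- by move=> _ [u [v [uv ->]]]; apply: edge_point => //; lra.
- move=> _ [u [v [uv ->]]]; apply: maximal_convex_star.
    by apply: edge_point => //; lra.
  by rewrite star_edge//; exact: convex_edge.
- rewrite eqEsubset.
  split=> [x /edge_cover[u [v [a [uv a01 ->]]]]|x [_ _ []//]].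
  exists (comb u v (1 - 2^-1) 2^-1); first by exists u, v.
  by rewrite star_edge//; exists a => //; rewrite /= in_itv.
- move=> x _ e x1 [u [v [uv ->]]] e0.
  have [s [t [-> [? ?] [? ?] [? ?]]]] := edge_coord_bounds uv x1.
  (* Raise both coordinates of s u + t v until they add up to 1; then the
     difference has coordinates of one sign, with sum 1 - (s + t).  On the
     opposite edge, lower them until they add up to -1. *)
  have [b [b01 sb tb]] : exists b, [/\ 0 <= b <= 1, s <= 1 - b & t <= b].
    by have [s0|s0] := leP 0 s; [exists (1 - s)|exists 1]; split; lra.
  have [c [c01 sc tc]] : exists c, [/\ 0 <= c <= 1, - s <= 1 - c & - t <= c].
    by have [s0|s0] := leP 0 (- s); [exists (1 + s)|exists 1]; split; lra.
  exists (comb u v (1 - b) b), (- comb u v (1 - c) c); split.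
  + by rewrite star_edge//; exists b => //; rewrite /= in_itv.
  + have : star (comb u v (1 - 2^-1) 2^-1) (comb u v (1 - c) c).
      by rewrite star_edge//; exists c => //; rewrite /= in_itv.
    by rewrite /star /unit_sphere /= -opprD !normrN.
  + have h1 : `|comb u v s t - comb u v (1 - b) b| <= 1 - (s + t).
      by rewrite combB; apply/(edge_norm_le _ _ _ uv); split; lra.
    have h2 : `|comb u v s t - - comb u v (1 - c) c| <= 1 + (s + t).
      by rewrite opprK combD; apply/(edge_norm_le _ _ _ uv); split; lra.
    lra.
Qed.

(** * Surjective isometries of the unit sphere *)

Section SphereIsometry.
Variables (R : realType) (Y : completeNormedModType R).
Variable T : X_half R -> Y.
Hypothesis T_onto : T @` unit_sphere (X_half R) = unit_sphere Y.
Hypothesis T_isom :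
  {in unit_sphere (X_half R) &, forall x x', `|T x - T x'| = `|x - x'|}.
Notation X := (X_half R).
Implicit Types (u v x y z : X) (s t a : R).

Let Tdist x y : `|x| = 1 -> `|y| = 1 -> `|T x - T y| = `|x - y|.
Proof. by move=> x1 y1; apply: T_isom; apply: mem_set. Qed.

Let Tnorm x : `|x| = 1 -> `|T x| = 1.
Proof.
by move=> x1; have : unit_sphere Y (T x) by rewrite -T_onto; exists x.
Qed.

Let Tsurj w : `|w| = 1 -> exists2 z : X, `|z| = 1 & T z = w.
Proof.
move=> w1; have : unit_sphere Y w by [].
by rewrite -T_onto => -[z z1 <-]; exists z.
Qed.

(** For an interior point of [u, v] this is edge_normD_eq2, because a point and
its antipodal image are at distance 2.  An end point belongs to two edges and has
a larger distance-2 set, so it is approximated by interior points. *)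
Lemma antipode_opposite_edge u v a s t : edge u v -> 0 <= a <= 1 ->
  `|comb u v s t| = 1 -> T (comb u v s t) = - T (comb u v (1 - a) a) ->
  s + t = -1.
Proof.
move=> uv a01 y1 Ty.
have [|? ? [st1 _]] := (edge_norm_le s t 1 uv).1; first by rewrite y1.
apply/eqP; rewrite eq_le st1 andbT; apply/ler_addgt0Pr => e e0.
have [d [d0 d1 de]] : exists d, [/\ 0 < d, d <= 1 & d <= e].
  by have [e1|e1] := leP e 1; [exists e|exists 1]; split; lra.
(* The parameter moves from a towards 1/2, hence into ]0, 1[, by at most e. *)
pose b := a + d * (2^-1 - a).
have b01 : 0 < b < 1 by rewrite /b; nra.
have b01' : 0 <= b <= 1 by lra.
have [|z z1 Tz] := Tsurj (w := - T (comb u v (1 - b) b)).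
  by rewrite normrN Tnorm// edge_point.
have [s' [t' zst]] := edge_coord z uv; rewrite zst in z1 Tz.
have st' : - s' - t' = 1.
  apply: (edge_normD_eq2 (a := b) uv) => //; first by rewrite -combN normrN z1.
  rewrite -combN addrC -Tdist// ?edge_point// Tz opprK -mulr2n normrMn.
  by rewrite Tnorm ?edge_point.
have : `|comb u v s t - comb u v s' t'| <= e.
  rewrite -Tdist// Ty Tz opprK addrC Tdist ?edge_point// combB.
  by apply/(edge_norm_le _ _ _ uv); rewrite /b; split; nra.
by rewrite combB => /(edge_norm_le _ _ _ uv)[_ _ [? ?]]; lra.
Qed.

(** The vertex u lies on two edges, so T^-1(- T u) lies on both opposite edges,
which meet only in - u. *)
Lemma antipode_vertex u v : edge u v -> T (- u) = - T u.
Proof.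
move=> uv; have uv' := edge_rotV uv.
have u1 := edge_vertex uv.
have [|y y1 Ty] := Tsurj (w := - T u); first by rewrite normrN Tnorm.
have [s [t yst]] := edge_coord y uv.
have yst' : y = comb (u - v) u (- t) (s + t).
  by rewrite yst comb_rotV; congr comb; ring.
have st : s + t = -1.
  apply: (antipode_opposite_edge (a := 0) uv); rewrite ?lexx ?ler01 -?yst//.
  by rewrite subr0 comb10.
have s1 : - t + (s + t) = -1.
  apply: (antipode_opposite_edge (a := 1) uv'); rewrite ?lexx ?ler01 -?yst'//.
  by rewrite subrr comb01.
rewrite -Ty yst -{1}(comb10 u v) combN; congr (T (comb _ _ _ _)); lra.
Qed.

(** Since T is odd at the end points of the edge of x, the point - T^-1(- T x) has
the same distances to them as x. *)
Lemma antipode x : `|x| = 1 -> T (- x) = - T x.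
Proof.
move=> x1; have [|y y1 Ty] := Tsurj (w := - T x); first by rewrite normrN Tnorm.
have [u [v [a [uv a01 xuv]]]] := edge_cover x1.
have u1 := edge_vertex uv.
have v1 := edge_vertex (edge_rot uv).
have xu : `|x - u| <= a.
  rewrite xuv -[X in _ - X](comb10 u v) combB.
  by apply/(edge_norm_le _ _ _ uv); split; lra.
have xv : `|x - v| <= 1 - a.
  rewrite xuv -[X in _ - X](comb01 u v) combB.
  by apply/(edge_norm_le _ _ _ uv); split; lra.
have Ndist w : `|w| = 1 -> T (- w) = - T w -> `|- y - w| = `|x - w|.
  move=> w1 Tw; rewrite -opprD normrN -[X in y + X]opprK -Tdist ?normrN// Tw Ty.
  by rewrite opprK addrC distrC Tdist.
suff xy : x = - y by rewrite {1}xy opprK.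
rewrite xuv; apply/esym/edge_between => //.
  by rewrite Ndist// (antipode_vertex uv).
by rewrite Ndist// (antipode_vertex (edge_rot uv)).
Qed.

Lemma sphere_normD x y : `|x| = 1 -> `|y| = 1 -> `|T x + T y| = `|x + y|.
Proof.
by move=> x1 y1; rewrite -[T y]opprK -antipode// Tdist ?normrN// opprK.
Qed.

(** The vector z of the sphere with T z = T v - T u satisfies |z + u| = |T v| = 1
and |z - v| = |- T u| = 1; of the unit vectors only v - u does. *)
Lemma edge_rot_image u v : edge u v -> T (v - u) = T v - T u.
Proof.
move=> uv; have u1 := edge_vertex uv; have v1 := edge_vertex (edge_rot uv).
have vu1 := edge_vertex (edge_rot (edge_rot uv)).
have [|z z1 Tz] := Tsurj (w := T v - T u); first by rewrite Tdist.
have zu : `|z + u| <= 1 by rewrite -sphere_normD// Tz subrK Tnorm.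
have zv : `|z - v| <= 1 by rewrite -Tdist// Tz addrAC subrr sub0r normrN Tnorm.
have [s [t zst]] := edge_coord z uv; rewrite zst in z1 Tz zu zv.
move: zu; rewrite -[X in _ + X](comb10 u v) combD.
move=> /(edge_norm_le _ _ _ uv)[[? ?] [? ?] [? ?]].
move: zv; rewrite -[X in _ - X](comb01 u v) combB.
move=> /(edge_norm_le _ _ _ uv)[[? ?] [? ?] [? ?]].
have s1 : s = -1.
  have := edge_norm_ge (s := s) (t := t) (c := 1) uv.
  by rewrite z1 => /(_ (lexx _)) []; rewrite ler_normr => /orP[]; lra.
have t1 : t = 1 by lra.
by rewrite -Tz s1 t1 /comb scaleN1r scale1r addrC.
Qed.

(** The point w of [T u, T v] with parameter a has norm 1, because w and its
mirror image in the segment add up to T u + T v, of norm 2.  So w = T z for some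
z, and z has the right distances to u and v. *)
Lemma edge_image u v a : edge u v -> 0 <= a <= 1 ->
  T (comb u v (1 - a) a) = comb (T u) (T v) (1 - a) a.
Proof.
move=> uv a01; have u1 := edge_vertex uv; have v1 := edge_vertex (edge_rot uv).
have Tu := Tnorm u1; have Tv := Tnorm v1.
have le1 b : 0 <= b <= 1 -> `|comb (T u) (T v) (1 - b) b| <= 1.
  move=> b01; apply: le_trans (ler_normD _ _) _; rewrite !normrZ Tu Tv !mulr1.
  by rewrite !ger0_norm; lra.
have uv2 : `|T u + T v| = 2.
  rewrite sphere_normD// -[X in X + _](comb10 u v) -[X in _ + X](comb01 u v).
  by rewrite combD addr0 add0r edge_norm// /hexnorm ger0_norm// ger0_norm//
    maxxx; apply/max_idPr; lra.
have w1 : `|comb (T u) (T v) (1 - a) a| = 1.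
  apply/eqP; rewrite eq_le le1//=.
  have a01' : 0 <= 1 - a <= 1 by lra.
  have := le1 _ a01'; rewrite subKr => ?.
  have := ler_normD (comb (T u) (T v) (1 - a) a) (comb (T u) (T v) a (1 - a)).
  by rewrite combD subrK [a + _]addrC subrK /comb !scale1r uv2; lra.
have [z z1 Tz] := Tsurj w1.
have vu1 : `|v - u| = 1 by exact: edge_vertex (edge_rot (edge_rot uv)).
rewrite -Tz; congr T; apply/esym/edge_between => //; rewrite -Tdist// Tz.
  rewrite -[X in _ - X](comb10 (T u) (T v)) combB.
  have -> : comb (T u) (T v) (1 - a - 1) (a - 0) = a *: (T v - T u).
    by rewrite /comb scalerBr subr0 addrC addrAC subrr sub0r scaleNr.
  by rewrite normrZ Tdist// vu1 mulr1 ger0_norm//; lra.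
rewrite -[X in _ - X](comb01 (T u) (T v)) combB.
have -> : comb (T u) (T v) (1 - a - 0) (a - 1) = (1 - a) *: (T u - T v).
  by rewrite /comb scalerBr subr0 -scaleNr opprB.
by rewrite normrZ Tdist// (distrC u) vu1 mulr1 ger0_norm//; lra.
Qed.

(** The coordinates of x with respect to the base edge are
x.1 - x.2 / 2 and x.2. *)
Let L x : Y := comb (T ((1, 0) : X)) (T ((2^-1, 1) : X)) (x.1 - x.2 / 2) x.2.

Let L_linear : linear L.
Proof.
move=> c x y; rewrite /L combZ combD.
by congr comb => /=; rewrite /GRing.scale /=; lra.
Qed.

HB.instance Definition _ := GRing.isLinear.Build R X Y *:%R L L_linear.

Let L_edge u v : edge u v -> T u = L u /\ T v = L v.
Proof.
elim=> [|{}u {}v uv [Tu Tv]].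
  split; rewrite /L /=; first by rewrite mul0r subr0 comb10.
  by rewrite mul1r subrr comb01.
by rewrite edge_rot_image// linearB Tu Tv.
Qed.

Let L_sphere x : `|x| = 1 -> T x = L x.
Proof.
move=> /edge_cover[u [v [a [uv a01 ->]]]]; have [Tu Tv] := L_edge uv.
by rewrite edge_image// /comb linearD !linearZ Tu Tv.
Qed.

Lemma sphere_isometry_linear : exists L : {linear X -> Y},
  [/\ forall x, `|L x| = `|x|, range L = [set: Y] &
      {in unit_sphere X, forall x, T x = L x}].
Proof.
exists L; split.
- move=> x; have [->|x0] := eqVneq x 0; first by rewrite linear0 !normr0.
  have nx : `|x| != 0 by rewrite normr_eq0.
  have x1 : `| `|x|^-1 *: x | = 1 by rewrite normrZ normfV normr_id mulVf.
  rewrite -{1}(scalerKV nx x) linearZ /= -L_sphere// normrZ normr_id.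
  by rewrite Tnorm// mulr1.
- rewrite eqEsubset; split=> // y _.
  have [->|y0] := eqVneq y 0; first by exists 0; rewrite // linear0.
  have ny : `|y| != 0 by rewrite normr_eq0.
  have [|z z1 Tz] := Tsurj (w := `|y|^-1 *: y).
    by rewrite normrZ normfV normr_id mulVf.
  by exists (`|y| *: z) => //; rewrite linearZ /= -L_sphere// Tz scalerKV.
- by move=> x; rewrite inE => /L_sphere.
Qed.

End SphereIsometry.

Theorem mainTheorem3 (R : realType) :
  T_property (X_half R) /\ Mazur_Ulam_property (X_half R).
Proof.
split; first exact: X_half_T_property.
by move=> Y T T_onto T_isom; exact: sphere_isometry_linear.
Qed.
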